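(* Suppose the star connected occupied component $C(0)$ containing the origin is finite. Then the outermost boundary $\partial_0$ of $C(0)$ is the union of a unique set of cycles $C_1, C_2, \ldots, C_n$ in the graph $G_0$ with the following properties: (i) Every edge in $\bigcup_{1\le i\le n} C_i$ is an outermost boundary edge. (ii) The graph $\bigcup_{1\le i\le n} C_i$ is a connected subgraph of $G_0$. (iii) If $i\ne j$, the cycles $C_i$ and $C_j$ have disjoint interiors and have at most one vertex in common. (iv) Every (occupied) square $J_k \in C(0)$ is contained in the interior of some cycle $C_j$. (v) If $e \in C_j$ for some $j$, then $e$ is a boundary edge adjacent to an occupied square of $C(0)$ contained in the interior of $C_j$ and also adjacent to a vacant square lying in the exterior of all the cycles $C_1,\dots,C_n$. Moreover, there exists a circuit $C_{out}$ containing every edge of $\bigcup_{1\le i\le n} C_i$.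
   Context: Tiling: $\mathbb{R}^2$ is tiled into unit squares $\{S_k\}_{k\ge 0}$ with disjoint interiors, the axis-parallel unit squares centred at the points of $\mathbb{Z}^2$, with the origin the centre of $S_0$. Every square is either occupied or vacant, and $S_0$ is always occupied. For $i \ne j$, $S_i$ and $S_j$ are star adjacent if they share a corner (in particular, squares sharing an edge are star adjacent). Component: $S_i$ is connected to $S_j$ by an occupied star connected $S$-path if there is a sequence of distinct occupied squares $(Y_1,\dots,Y_t)$ from $\{S_k\}$ with $Y_1=S_i$, $Y_t=S_j$ and $Y_l$ star adjacent to $Y_{l+1}$ for $1\le l\le t-1$. $C(0)$ is the collection of all occupied squares connected to $S_0$ by an occupied star connected $S$-path (it contains $S_0$). When $C(0)$ is finite, its squares are denoted $\{J_k\}_{1\le k\le M}$. Graph: $G_0$ is the graph whose vertices are the corners of the squares of $C(0)$ and whose edges are the (unit length) edges of the squares of $C(0)$. Two edges are adjacent if they share an endvertex. An edge is adjacent to a square if it is one of the four edges of that square. Paths, cycles, circuits: a path is a sequence of distinct edges $(e_1,\dots,e_t)$ of $G_0$ with $e_i$ and $e_{i+1}$ adjacent for $1\le i\le t-1$. A circuit is a sequence of distinct edges $(e_1,\dots,e_t)$ such that $(e_1,\dots,e_{t-1})$ is a path and $e_t$ shares one endvertex with $e_1$ and its other endvertex with $e_{t-1}$. A cycle is a simple (non-self-intersecting) cycle of the graph, i.e. every vertex of the cycle is an endvertex of exactly two of its edges. Interior/exterior: a cycle $C$ divides the plane into a bounded connected region, its interior, and an unbounded connected region, its exterior. A square lies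 in the interior (resp. exterior) of $C$ if its open square is contained in the interior (resp. exterior) of $C$. An edge $e$ is contained in the interior (resp. exterior) of $C$ if both squares of $\{S_k\}$ having $e$ as an edge lie in the interior (resp. exterior) of $C$. Boundary edges: an edge $e$ is a boundary edge if it is adjacent to a vacant square and also adjacent to an occupied square of $C(0)$. An edge $e$ of $G_0$ is an outermost boundary edge of $C(0)$ if for every cycle $C$ in $G_0$, either $e$ is an edge of $C$ or $e$ belongs to the exterior of $C$. The outermost boundary $\partial_0$ of $C(0)$ is the set of all outermost boundary edges of $G_0$. *)

(* Defs.v *)
From HB Require Import structures.
From mathcomp Require Import all_boot all_order all_algebra.
From mathcomp Require Import finmap.
From mathcomp Require Import all_classical all_reals all_analysis.

Set Implicit Arguments.
Unset Strict Implicit.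
Unset Printing Implicit Defensive.

Import Order.TTheory GRing.Theory Num.Theory.
Import numFieldNormedType.Exports.

Local Open Scope classical_set_scope.
Local Open Scope ring_scope.

(* A square is named by its centre in Z^2; the vertex [(a, b)] names the point
   (a + 1/2, b + 1/2) of the plane, so that corners have integer coordinates. *)
Notation square := (int * int)%type (only parsing).
Notation vertex := (int * int)%type (only parsing).

(* [(v, false)] is the horizontal unit edge whose left end is [v], and
   [(v, true)] is the vertical unit edge whose lower end is [v]. *)
Notation edge := (vertex * bool)%type (only parsing).

Definition ends (e : edge) : seq vertex :=
  let: ((a, b), d) := e in
  [:: (a, b); if d then (a, b + 1) else (a + 1, b)].

Definition corners (z : square) : seq vertex :=
  let: (a, b) := z in [:: (a - 1, b - 1); (a, b - 1); (a, b); (a - 1, b)].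

(* In the order bottom, right, top, left. *)
Definition sides (z : square) : seq edge :=
  let: (a, b) := z in
  [:: ((a - 1, b - 1), false); ((a, b - 1), true);
      ((a - 1, b), false); ((a - 1, b - 1), true)].

Definition star_adj : rel square :=
  fun z w => (z != w) && has (mem (corners w)) (corners z).

(* [occ] is the set of occupied squares; the other squares are vacant. *)
Definition star_connected (occ : set square) (z w : square) : Prop :=
  exists s : seq square,
    [/\ uniq (z :: s), forall y, y \in z :: s -> occ y,
        path star_adj z s & last z s = w].

Definition component (occ : set square) : set square :=
  [set z | star_connected occ (0, 0) z].

(* A graph is given by its set of edges: none of the graphs below has an
   isolated vertex. *)
Definition G0 (occ : set square) : set edge :=
  [set e | exists2 z, component occ z & e \in sides z].

Definition edge_adj : rel edge :=
  fun e f => (e != f) && has (mem (ends f)) (ends e).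

(* A path need not be a walk in the usual sense: three consecutive edges may
   share one vertex. *)
Definition is_path (E : set edge) (s : seq edge) : Prop :=
  [/\ uniq s, sorted edge_adj s & forall e, e \in s -> E e].

(* The circuit (e_1, ..., e_(t-1), e_t) is [rcons (e1 :: s) et]. *)
Definition is_circuit (E : set edge) (c : seq edge) : Prop :=
  exists e1 s et,
    [/\ c = rcons (e1 :: s) et, uniq c, E et, is_path E (e1 :: s) &
        exists u v, [/\ u != v, u \in ends et, v \in ends et,
                        u \in ends e1 & v \in ends (last e1 s)]].

Definition on_graph (E : set edge) (v : vertex) : Prop :=
  exists2 e, E e & v \in ends e.

(* A cycle is identified with its set of edges, so that neither the starting
   edge nor the orientation matters. *)
Definition is_cycle (E : set edge) (C : {fset edge}) : Prop :=
  exists c, [/\ is_circuit E c, C =i c &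
    forall v, on_graph [set` C] v -> count (fun e => v \in ends e) c = 2%N].

Definition is_connected (E : set edge) : Prop :=
  forall u v, on_graph E u -> on_graph E v ->
    exists e s, [/\ is_path E (e :: s), u \in ends e & v \in ends (last e s)].

Definition subgraph_union (Cs : {fset {fset edge}}) : set edge :=
  [set e | exists2 C : {fset edge}, C \in Cs & e \in C].

Definition point (R : realType) (v : vertex) : R * R :=
  (v.1%:~R + 2^-1, v.2%:~R + 2^-1).

Definition segment (R : realType) (e : edge) : set (R * R) :=
  [set p | exists (u v : vertex) (t : R), [/\ ends e = [:: u; v], 0 <= t <= 1 &
     p = (1 - t) *: point R u + t *: point R v]].

Definition curve (R : realType) (C : {fset edge}) : set (R * R) :=
  [set p | exists2 e, e \in C & segment e p].

Definition open_square (R : realType) (z : square) : set (R * R) :=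
  [set p | `|p.1 - z.1%:~R| < 2^-1 /\ `|p.2 - z.2%:~R| < 2^-1].

(* The union of the bounded connected components of the complement of the
   cycle, and the union of the unbounded ones. *)
Definition cycle_interior (R : realType) (C : {fset edge}) : set (R * R) :=
  [set p | ~ curve C p /\ bounded_set (connected_component (~` curve C) p)].

Definition cycle_exterior (R : realType) (C : {fset edge}) : set (R * R) :=
  [set p | ~ curve C p /\ ~ bounded_set (connected_component (~` curve C) p)].

Definition in_interior (R : realType) (C : {fset edge}) (z : square) : Prop :=
  @open_square R z `<=` @cycle_interior R C.

Definition in_exterior (R : realType) (C : {fset edge}) (z : square) : Prop :=
  @open_square R z `<=` @cycle_exterior R C.

Definition edge_in_exterior (R : realType) (C : {fset edge}) (e : edge) : Prop :=
  forall z, e \in sides z -> in_exterior R C z.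

Definition boundary_edge (occ : set square) (e : edge) : Prop :=
  (exists2 z, ~ occ z & e \in sides z) /\
  (exists2 z, component occ z & e \in sides z).

Definition outermost_boundary (R : realType) (occ : set square) : set edge :=
  [set e | G0 occ e /\
    forall C, is_cycle (G0 occ) C -> e \in C \/ edge_in_exterior R C e].

Record boundary_cycles (R : realType) (occ : set square)
    (Cs : {fset {fset edge}}) : Prop := BoundaryCycles {
  bc_cycle : forall C : {fset edge}, C \in Cs -> is_cycle (G0 occ) C;
  bc_union : outermost_boundary R occ = subgraph_union Cs;
  bc_outermost : forall e, subgraph_union Cs e -> outermost_boundary R occ e;
  bc_connected : subgraph_union Cs `<=` G0 occ /\
    is_connected (subgraph_union Cs);
  bc_disjoint : forall C D : {fset edge}, C \in Cs -> D \in Cs -> C != D ->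
    @cycle_interior R C `&` @cycle_interior R D = set0 /\
    forall u v, on_graph [set` C] u -> on_graph [set` D] u ->
      on_graph [set` C] v -> on_graph [set` D] v -> u = v;
  bc_cover : forall z, component occ z ->
    exists2 C : {fset edge}, C \in Cs & in_interior R C z;
  bc_sides : forall (C : {fset edge}) (e : edge), C \in Cs -> e \in C ->
    [/\ boundary_edge occ e,
        exists z, [/\ component occ z, e \in sides z & in_interior R C z] &
        exists z, [/\ ~ occ z, e \in sides z &
          forall D : {fset edge}, D \in Cs -> in_exterior R D z]]
}.

(* Main.v *)
Require Import Defs.
From mathcomp Require Import all_boot all_order all_algebra.
From mathcomp Require Import finmap zify lra.
From mathcomp Require Import all_classical all_reals all_analysis.

(** Let [outer] be the unbounded edge-connected part of the complement of the
    component K = C(0), and let the rim consist of the edges separating [outer]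
    from the rest.  The sought cycles are the boundaries ("loops") of the
    edge-connected regions cut out by the rim.

    The only planarity input is a ray-crossing parity: an edge set D of even
    degree has a 0/1 potential on squares that changes exactly across the edges
    of D.  If D lies in the rim, its potential is constant on each region and
    vanishes on [outer], so D is a union of loops.  Hence no loop has a proper
    nonempty even subset: it is connected, and its Euler circuit revisits no
    vertex, so it is a cycle.  Two loops with two common vertices would give, by
    joining an arc of each, an even subset of the rim that is not a union of
    loops.  Any cycle in the rim is a loop, whence uniqueness, and the rim is
    connected because K is star connected, so its Euler circuit is C_out.

    Topologically, the component in the complement of a cycle of a point in an
    open square is covered by the closed squares reachable from it without
    crossing the cycle, by a clopen argument; it is bounded iff these squares
    are. *)

Set Implicit Arguments.
Unset Strict Implicit.
Unset Printing Implicit Defensive.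

Import Order.TTheory GRing.Theory Num.Theory.
Import numFieldNormedType.Exports.

Local Open Scope classical_set_scope.
Local Open Scope ring_scope.

(** * Squares, walks and even edge sets *)

(* The two squares having [e] as a side: left and right of a vertical edge,
   below and above a horizontal one. *)
Definition sq1 (e : edge) : square :=
  let: ((x, y), d) := e in if d then (x, y + 1) else (x + 1, y).
Definition sq2 (e : edge) : square :=
  let: ((x, y), d) := e in (x + 1, y + 1).

Lemma mem_sides (e : edge) (z : square) :
  (e \in sides z) = (z == sq1 e) || (z == sq2 e).
Proof.
case: e z => [[x y] []] [a b]; rewrite /sides /sq1 /sq2 !inE !xpair_eqE /=; lia.
Qed.

(* Connection by edge-adjacent squares without crossing an edge of [B], stated
   as an induction principle. *)
Definition linked (B : set edge) (z w : square) : Prop :=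
  forall P : set square,
    (forall e, ~ B e -> (P (sq1 e) <-> P (sq2 e))) -> P z -> P w.

Lemma linked_refl B z : linked B z z. Proof. by []. Qed.

Lemma linked_trans B y z w : linked B y z -> linked B z w -> linked B y w.
Proof. by move=> yz zw P cP /(yz P cP)/(zw P cP). Qed.

(** The complement of an invariant set is again invariant, so the one-way induction principle works
    in both directions. *)
Lemma linked_sym B z w : linked B z w -> linked B w z.
Proof.
move=> zw P cP Pw; apply: contrapT => nPz.
by apply: (zw (~` P)) Pw => // e /cP; rewrite /setC/=; tauto.
Qed.

Lemma linked_sub (A B : set edge) z w :
  A `<=` B -> linked B z w -> linked A z w.
Proof. by move=> AB zw P cP; apply: zw => e nBe; apply: cP => /AB. Qed.

Lemma linked_edge (B : set edge) e : ~ B e -> linked B (sq1 e) (sq2 e).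
Proof. by move=> nBe P /(_ _ nBe)[]. Qed.

Lemma linked_closed (B : set edge) z e : ~ B e ->
  linked B z (sq1 e) <-> linked B z (sq2 e).
Proof.
move=> nBe; split=> /linked_trans; apply; last apply: linked_sym.
all: exact: linked_edge.
Qed.

(* Junk value (the first end of [e]) when [v] is not an end of [e]. *)
Definition opp (e : edge) (v : vertex) : vertex :=
  let: (w, d) := e in
  if v == w then (if d then (w.1, w.2 + 1) else (w.1 + 1, w.2)) else w.

Lemma mem_ends (e : edge) (v x : vertex) : v \in ends e ->
  (x \in ends e) = (x == v) (+) (x == opp e v).
Proof.
case: e v x => [[a b] []] [x y] [p q]; rewrite /ends /opp !inE !xpair_eqE /=;
  case: ifP => /=; rewrite !xpair_eqE; lia.
Qed.

Lemma opp_neq (e : edge) (v : vertex) : v \in ends e -> opp e v != v.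
Proof.
case: e v => [[a b] []] [x y]; rewrite /ends /opp !inE !xpair_eqE /=;
  case: ifP => /=; rewrite !xpair_eqE; lia.
Qed.

Lemma opp_ends (e : edge) (v : vertex) : v \in ends e -> opp e v \in ends e.
Proof. by move=> ve; rewrite (mem_ends _ ve) eqxx (negbTE (opp_neq ve)). Qed.

Lemma opp_cases (e : edge) (v x : vertex) : v \in ends e -> x \in ends e ->
  x = v \/ x = opp e v.
Proof.
by move=> ve; rewrite (mem_ends _ ve); case: eqP; case: eqP; auto.
Qed.

Lemma mem_ends_nat (e : edge) (v x : vertex) : v \in ends e ->
  (x \in ends e : nat) = ((x == v) + (x == opp e v))%N.
Proof.
move=> ve; rewrite (mem_ends _ ve); case: eqP => [->|]; last by case: eqP.
by rewrite eq_sym (negbTE (opp_neq ve)).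
Qed.

(* Unlike [is_path], successive edges are traversed end to end from [u]. *)
Fixpoint walk (u : vertex) (s : seq edge) : bool :=
  if s is e :: s' then (u \in ends e) && walk (opp e u) s' else true.

Definition wend (u : vertex) (s : seq edge) : vertex :=
  foldl (fun v e => opp e v) u s.

Lemma wend_cat u s t : wend u (s ++ t) = wend (wend u s) t.
Proof. exact: foldl_cat. Qed.

Lemma walk_cat u s t : walk u (s ++ t) = walk u s && walk (wend u s) t.
Proof. by elim: s u => //= e s IH u; rewrite IH andbA. Qed.

Definition deg (s : seq edge) (v : vertex) : nat :=
  count (fun e => v \in ends e) s.

(** Each traversed edge flips the parity at its two ends, and the contributions telescope along the
    walk. *)
Lemma odd_deg_walk u s v :
  walk u s -> odd (deg s v) = (v == u) (+) (v == wend u s).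
Proof.
rewrite /deg; elim: s u => [|e s IH] u /=; first by rewrite addbb.
case/andP=> ue /IH; rewrite oddD => ->; rewrite oddb (mem_ends _ ue).
by case: (_ == u); case: (_ == opp e u); case: (_ == _).
Qed.

Lemma walk_visit u s e v : walk u s -> e \in s -> v \in ends e ->
  exists s1 s2, s = s1 ++ s2 /\ wend u s1 = v.
Proof.
elim: s u => //= f s IH u /andP[uf ws]; rewrite inE => /predU1P[->|es] ve.
  have [->|->] := opp_cases uf ve; first by exists [::], (f :: s).
  by exists [:: f], s.
have [s1 [s2 [-> <-]]] := IH _ ws es ve.
by exists (f :: s1), s2.
Qed.

(** Starting at [v] and ending at [v] account for one incidence each; any further incidence comes
    from a passage through [v] in the middle. *)
Lemma walk_revisit u s v : walk u s ->
  ((v == u) + (v == wend u s) < deg s v)%N ->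
  exists s1 s2, [/\ s = s1 ++ s2, s1 != [::], s2 != [::] & wend u s1 = v].
Proof.
rewrite /deg; elim: s u => //= e s IH u /andP[ue ws].
rewrite (mem_ends_nat _ ue) -!addnA ltn_add2l.
have [-> lt|sn0] := eqVneq s [::]; first by rewrite /= in lt; lia.
case: (eqVneq v (opp e u)) => [-> _|nv].
  by exists [:: e], s; split.
have := IH _ ws; rewrite (negbTE nv) => H /H[s1 [s2 [-> s1n s2n <-]]].
by exists (e :: s1), s2.
Qed.

(** * Vertex degrees and even edge sets *)

Definition star (v : vertex) : seq edge :=
  [:: (v, false); ((v.1 - 1, v.2), false); (v, true); ((v.1, v.2 - 1), true)].

Lemma mem_star v e : (e \in star v) = (v \in ends e).
Proof.
case: e v => [[a b] []] [x y]; rewrite /ends /star !inE !xpair_eqE /=; lia.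
Qed.

Lemma star_uniq v : uniq (star v).
Proof. by case: v => x y; rewrite /star /= !inE !xpair_eqE /=; lia. Qed.

(** Turns a degree into a sum of four membership bits, so that parity claims become Boolean checks
    around one vertex. *)
Lemma deg_star s v : uniq s -> deg s v = count (mem s) (star v).
Proof.
move=> us; rewrite /deg -!size_filter; apply/perm_size/uniq_perm.
- exact: filter_uniq.
- exact/filter_uniq/star_uniq.
- by move=> e; rewrite !mem_filter mem_star andbC.
Qed.

Lemma eq_deg s t v : uniq s -> uniq t -> s =i t -> deg s v = deg t v.
Proof. by move=> us ut st; rewrite !deg_star //; apply: eq_count. Qed.

Definition even_edges (D : {fset edge}) : Prop := forall v, ~~ odd (deg D v).

(** Going once around a vertex through its four squares, [P] changes value an even number of
    times. *)
Lemma even_cut (P : square -> bool) (D : {fset edge}) :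
  (forall e, (e \in D) = P (sq1 e) (+) P (sq2 e)) -> even_edges D.
Proof.
move=> DP [x y]; rewrite deg_star ?fset_uniq //= !DP /= !subrK !addn0.
case: (P (x + 1, y)); case: (P (x + 1, y + 1)); case: (P (x, y)).
all: by case: (P (x, y + 1)).
Qed.

Lemma int_up_ind (P : int -> Prop) (m : int) :
  P m -> (forall k, m <= k -> P k -> P (k + 1)) -> forall k, m <= k -> P k.
Proof.
move=> Pm PS k mk; have -> : k = m + `|k - m|%N%:Z by lia.
elim: `|k - m|%N => [|n IH]; first by rewrite addr0.
by rewrite -addn1 PoszD addrA; apply: PS => //; lia.
Qed.

Lemma int_down_ind (P : int -> Prop) (m : int) :
  P m -> (forall k, k < m -> P (k + 1) -> P k) -> forall k, k <= m -> P k.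
Proof.
move=> Pm PS k km; have -> : k = m - `|k - m|%N%:Z by lia.
elim: `|k - m|%N => [|n IH]; first by rewrite subr0.
apply: PS; first lia.
by have -> : m - n.+1%:Z + 1 = m - n%:Z by lia.
Qed.

Lemma seq_bounded (T : Type) (f : T -> int) (s : seq T) :
  exists N : int, 0 <= N /\ all (fun x => `|f x| <= N) s.
Proof.
elim: s => [|x s [N [N0 sN]]]; first by exists 0.
exists (`|f x| + N); split => /=; first by lia.
apply/andP; split; first lia.
by apply: sub_all sN => y /=; lia.
Qed.

(* The potential is the parity of the number of edges of [D] crossed by the
   rightward horizontal ray from the centre of the square. *)
Lemma even_potential (D : {fset edge}) : even_edges D ->
  exists n : square -> bool,
    (forall e, (e \in D) = n (sq1 e) (+) n (sq2 e)) /\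
    exists N : int, forall a b, N < a -> n (a, b) = false.
Proof.
move=> evD.
have [N [N0 /allP DN]] := seq_bounded (fun e : edge => e.1.1) D.
pose n (z : square) :=
  odd (count (fun e : edge => [&& e.2, e.1.2 == z.2 - 1 & z.1 <= e.1.1]) D).
have nfar a b : N < a -> n (a, b) = false.
  move=> Na; rewrite /n (@eq_in_count _ _ pred0) ?count_pred0 // => e /DN /=.
  by case: e => [[x y] d] /=; lia.
have nright a b : n (a, b) = n (a + 1, b) (+) (((a, b - 1), true) \in D).
  rewrite /n -(oddb (_ \in D)) -(@count_uniq_mem _ D) ?fset_uniq //.
  rewrite -oddD -count_predUI (@eq_count _ (predI _ _) pred0); last first.
    by move=> [[x y] d]; rewrite /= !xpair_eqE; lia.
  rewrite count_pred0 addn0; congr odd; apply: eq_count.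
  by move=> [[x y] d]; rewrite /= !xpair_eqE; lia.
have nup a b : n (a, b) (+) n (a, b + 1) = (((a - 1, b), false) \in D).
  (* Leftward induction from beyond all edges of [D], where both sides vanish. The even degree at
     [(a, b)] carries the identity from column [a + 1] to column [a]. *)
  have [Na|aN] := ltP (N + 1) a.
    rewrite !nfar; try lia; apply/esym/negP => /DN /=; lia.
  move: a aN; apply: int_down_ind => [|a aN IH].
    rewrite addrK nright (nright _ (b + 1)) !nfar //=; try lia.
    have := evD (N + 1, b); rewrite deg_star ?fset_uniq //= !addn0 !addrK.
    have /negbTE-> : ((N + 1, b), true) \notin D by apply/negP => /DN /=; lia.
    have /negbTE-> : ((N + 1, b), false) \notin D by apply/negP => /DN /=; lia.
    by case: (_ \in D); case: (_ \in D).
  rewrite nright (nright _ (b + 1)) addrK.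
  have := evD (a, b); rewrite deg_star ?fset_uniq //= !addn0.
  move: IH; rewrite addrK => <-.
  move: (n _) (n _) => x y.
  by case: x; case: y; do 3!case: (_ \in D).
exists n; split; last by exists N => a b; apply: nfar.
move=> [[x y] []] /=.
  by rewrite (nright x) addrK; case: (n _); case: (_ \in D).
by rewrite nup addrK.
Qed.

(** * Connected even edge sets and Euler trails *)

Definition edge_connected (E : {fset edge}) : Prop :=
  forall P : pred edge, (exists2 e, e \in E & P e) ->
    (forall e f v, e \in E -> f \in E -> P e -> v \in ends e -> v \in ends f ->
       P f) ->
    forall e, e \in E -> P e.

Definition closed_trail (E : {fset edge}) (u : vertex) (s : seq edge) : Prop :=
  [/\ walk u s, wend u s = u, uniq s & s =i E].

Lemma closed_trail_rot (E : {fset edge}) u s e v :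
  closed_trail E u s -> e \in E -> v \in ends e ->
  exists t, closed_trail E v t.
Proof.
case=> ws cs us sE; rewrite -sE => es ve.
have [s1 [s2 [def_s s1v]]] := walk_visit ws es ve.
exists (s2 ++ s1); move: ws cs us sE.
rewrite def_s walk_cat wend_cat s1v => /andP[w1 w2] c2 us sE; split.
- by rewrite walk_cat w2 c2.
- by rewrite wend_cat c2.
- by rewrite uniq_catC.
- by move=> f; rewrite mem_cat orbC -mem_cat sE.
Qed.

(* A longest trail is closed by parity; if it missed an edge, rotating it to a
   vertex of a missed edge would allow an extension. *)
Lemma euler (E : {fset edge}) : E != fset0 -> even_edges E ->
  edge_connected E -> exists u s, closed_trail E u s.
Proof.
case/fset0Pn => e0 e0E evE conE.
pose T n := `[< exists u s, [/\ walk u s, uniq s, {subset s <= E} & size s = n] >].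
have exT : exists n, T n by exists 0%N; apply/asboolP; exists 0, [::].
have boundT n : T n -> (n <= #|` E|)%N.
  by move=> /asboolP[u [s [_ us sE <-]]]; apply: uniq_leq_size.
case: (ex_maxnP exT boundT) => m /asboolP[u [s [ws us sE szs]]] maxm.
have nolonger u' s' : walk u' s' -> uniq s' -> {subset s' <= E} ->
    (size s' <= size s)%N.
  by move=> *; rewrite szs; apply: maxm; apply/asboolP; exists u', s'.
have noext u' t f : walk u' t -> uniq t -> {subset t <= E} -> size t = size s ->
    f \in E -> wend u' t \in ends f -> f \in t.
  move=> wt ut tE szt fE tf; apply/negPn/negP => nft.
  have : (size (t ++ [:: f]) <= size s)%N.
    apply: (nolonger u').
    - by rewrite walk_cat wt /= tf.
    - by rewrite cats1 rcons_uniq nft.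
    - by move=> g; rewrite mem_cat inE => /orP[/tE|/eqP->].
  by rewrite size_cat szt addn1 ltnn.
(* An open trail has odd degree at its end [w]. But by [noext] it uses every edge of [E] at [w], and
   these are even in number. *)
have cs : wend u s = u.
  apply/eqP/negPn/negP => ne; set w := wend u s in ne.
  have : odd (deg s w) by rewrite (odd_deg_walk _ ws) eqxx addbT.
  suff -> : deg s w = deg E w by rewrite (negbTE (evE w)).
  rewrite !deg_star ?fset_uniq //; apply: eq_in_count => f.
  rewrite mem_star /= => wf; apply/idP/idP => [/sE//|fE].
  exact: (noext u).
have sn0 : (0 < size s)%N.
  apply: (@leq_trans (size [:: e0])) => //; apply: (nolonger e0.1) => //=.
    by case: e0 {e0E} => [[a b] d]; rewrite /= inE eqxx.
  by move=> f; rewrite inE => /eqP->.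
exists u, s; split=> // e; apply/idP/idP => [/sE//|]; move: e.
apply: (conE (mem s)).
  by case: (s) sE sn0 => // f s' sE _; exists f; rewrite ?sE ?inE ?eqxx.
move=> e f v eE fE /= es ve vf.
have [s1 [s2 [def_s s1v]]] := walk_visit ws es ve.
have perm_s : perm_eq (s2 ++ s1) s by rewrite def_s perm_catC.
rewrite -(perm_mem perm_s); apply: (noext v).
- by move: ws cs; rewrite def_s walk_cat wend_cat s1v => /andP[w1 w2] c2; rewrite walk_cat w2 c2.
- by rewrite (perm_uniq perm_s).
- by move=> g; rewrite (perm_mem perm_s); apply: sE.
- exact: perm_size.
- exact: fE.
- by move: cs; rewrite def_s !wend_cat s1v => ->; rewrite s1v.
Qed.

Lemma edge_adjP e f v : e != f -> v \in ends e -> v \in ends f -> edge_adj e f.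
Proof. by move=> ef ve vf; rewrite /edge_adj ef; apply/hasP; exists v. Qed.

Lemma trail_path u e s : walk u (e :: s) -> uniq (e :: s) -> path edge_adj e s.
Proof.
elim: s u e => //= f s IH u e /and3P[ue oe ws] /and3P[nf nfs us].
rewrite (IH (opp e u)) ?oe ?ws ?nfs ?us // andbT.
apply: edge_adjP oe; last exact: opp_ends.
by move: nf; rewrite inE negb_or => /andP[].
Qed.

Lemma walk_last_ends u e s : walk u (e :: s) -> wend u (e :: s) \in ends (last e s).
Proof.
elim: s u e => [|f s IH] u e /=; first by rewrite andbT => /opp_ends.
by case/and3P=> ue oe ws; apply: (IH (opp e u)); rewrite /= oe ws.
Qed.

(** A single edge has distinct ends and cannot close up, so the trail has at least two edges; its
    last edge leads from the end of the others back to [u]. *)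
Lemma closed_trail_circuit (E : {fset edge}) (G : set edge) u s :
  E != fset0 -> [set` E] `<=` G -> closed_trail E u s -> is_circuit G s.
Proof.
move=> /fset0Pn[e0 e0E] EG [ws cs us sE].
case: s => [|e s] in ws cs us sE *; first by rewrite -sE in e0E.
case/lastP: s => [|s f] in ws cs us sE *.
  by move: ws cs => /= /andP[/opp_neq + _] => /[swap] ->; rewrite eqxx.
have def_s : e :: rcons s f = rcons (e :: s) f by [].
move: (ws) cs us sE; rewrite def_s -cats1 walk_cat wend_cat cats1.
move=> /andP[w1 /andP[w2 _]] c2 us sE.
exists e, s, f; split => //.
- by apply/EG; rewrite /= -sE mem_rcons mem_head.
- have [ue1 ue2] : uniq (e :: s) /\ f \notin e :: s.
    by move: us; rewrite rcons_uniq => /andP[].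
  split=> //; first exact: (trail_path w1).
  by move=> g gs; apply/EG; rewrite /= -sE mem_rcons inE gs orbT.
- have c2' : opp f (wend u (e :: s)) = u := c2.
  exists u, (wend u (e :: s)); split.
  + by rewrite -{1}c2'; apply: opp_neq.
  + by rewrite -{1}c2'; apply: opp_ends.
  + exact: w2.
  + by case/andP: w1.
  + exact: walk_last_ends.
Qed.

Lemma edge_connected_is_connected (E : {fset edge}) :
  edge_connected E -> is_connected [set` E].
Proof.
move=> conE u v [e /= eE ue] [f /= fE vf].
have : exists s, [/\ path edge_adj e s, last e s = f & {subset e :: s <= E}].
  pose P g := `[< exists s, [/\ path edge_adj e s, last e s = g & {subset e :: s <= E}] >].
  apply/asboolP; apply: (conE P) fE.
    exists e => //; apply/asboolP; exists [::]; split=> // g.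
    by rewrite inE => /eqP->.
  move=> g h x gE hE /asboolP[s [ps ls sE]] xg xh; apply/asboolP.
  have [<-|gh] := eqVneq g h; first by exists s.
  exists (rcons s h); split; rewrite ?last_rcons //.
    by rewrite rcons_path ps ls (edge_adjP gh xg xh).
  by move=> k; rewrite -rcons_cons mem_rcons inE => /predU1P[->|/sE].
case=> s [ps lf sE]; rewrite -lf in vf.
(* The chain may repeat edges, whereas [is_path] asks for distinct ones. *)
case/shortenP: ps vf => t pt ut st vf.
exists e, t; split=> //; split=> // g; rewrite inE => /predU1P[->//|/st gs].
by apply: sE; rewrite inE gs orbT.
Qed.

(** * Topology of the complement of a cycle *)

Section Topology.
Variable R : realType.
Implicit Types (p q : R * R) (z w : square) (e f : edge) (C : {fset edge}).

Lemma segment_component (A : set (R * R)) p q :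
  (forall t : R, 0 <= t <= 1 -> A ((1 - t) *: p + t *: q)) ->
  connected_component A p q.
Proof.
move=> segA.
pose f (t : R) : R * R := (1 - t) *: p + t *: q.
exists [set f t | t in `[0, 1]]; last first.
  by exists 1; rewrite /= ?in_itv /= ?ler01 ?lexx // /f subrr scale0r add0r scale1r.
split.
- by exists 0; rewrite /= ?in_itv /= ?ler01 ?lexx // /f subr0 scale0r addr0 scale1r.
- by move=> _ [t t01 <-]; apply: segA; move: t01; rewrite /= in_itv.
- apply: connected_continuous_connected; first exact: segment_connected.
  apply: continuous_subspaceT => t; apply: cvgD.
    by apply: cvgZr_tmp; apply: cvgB; [exact: cvg_cst | exact: cvg_id].
  by apply: cvgZr_tmp; exact: cvg_id.
Qed.

Lemma scale_regular (a b : R) : a *: b = a * b.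
Proof. by []. Qed.

Definition center z : R * R := (z.1%:~R, z.2%:~R).

Definition closed_square z : set (R * R) :=
  [set p | `|p.1 - z.1%:~R| <= 2^-1 /\ `|p.2 - z.2%:~R| <= 2^-1].

Lemma open_closed_square z p : open_square z p -> closed_square z p.
Proof. by case=> /ltW ? /ltW. Qed.

Lemma open_square_center z : open_square z (center z).
Proof. by rewrite /open_square /= !subrr normr0 invr_gt0 ltr0n. Qed.

(** Replaces the parametrised segment by inequalities on coordinates, so that curves are handled
    through closed squares only. *)
Lemma segmentE e p :
  segment e p <-> closed_square (sq1 e) p /\ closed_square (sq2 e) p.
Proof.
case: e p => [[x y] d] [p1 p2]; split.
  case=> -[a b] [[a' b'] [t [+ /andP[t0 t1] +]]].
  case: d => -[<- <- <- <-]; rewrite /Defs.point /= => -[-> ->].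
    rewrite /closed_square /sq1 /sq2 /= !scale_regular !ler_norml !intrD /=.
    by split; split; apply/andP; split; nra.
  rewrite /closed_square /sq1 /sq2 /= !scale_regular !ler_norml !intrD /=.
  by split; split; apply/andP; split; nra.
case: d; rewrite /closed_square /sq1 /sq2 /= !ler_norml !intrD /=.
  move=> [[/andP[h1 h2] /andP[h3 h4]] [/andP[h5 h6] /andP[h7 h8]]].
  (* The parameter is the height above the lower end, which lies at ordinate [y + 1/2]. *)
  exists (x, y), (x, y + 1), (p2 - y%:~R - 2^-1); split=> //; first by lra.
  by rewrite /Defs.point /= intrD; congr pair; rewrite /= !scale_regular; lra.
move=> [[/andP[h1 h2] /andP[h3 h4]] [/andP[h5 h6] /andP[h7 h8]]].
exists (x, y), (x + 1, y), (p1 - x%:~R - 2^-1); split=> //; first by lra.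
by rewrite /Defs.point /= intrD; congr pair; rewrite /= !scale_regular; lra.
Qed.

Lemma near_int (x : R) (a b : int) :
  `|x - a%:~R| < 2^-1 -> `|x - b%:~R| <= 2^-1 -> b = a.
Proof.
rewrite ltr_norml ler_norml => /andP[h1 h2] /andP[h3 h4].
have : a%:~R < (b + 1)%:~R :> R by rewrite intrD /=; lra.
have : b%:~R < (a + 1)%:~R :> R by rewrite intrD /=; lra.
by rewrite !ltr_int; lia.
Qed.

Lemma near_ints (x : R) (a b : int) :
  `|x - a%:~R| <= 2^-1 -> `|x - b%:~R| <= 2^-1 -> `|a - b| <= 1.
Proof.
rewrite !ler_norml => /andP[h1 h2] /andP[h3 h4].
have : a%:~R <= (b + 1)%:~R :> R by rewrite intrD /=; lra.
have : b%:~R <= (a + 1)%:~R :> R by rewrite intrD /=; lra.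
by rewrite !ler_int; lia.
Qed.

Lemma open_square_uniq z w p : open_square z p -> closed_square w p -> w = z.
Proof.
case: z w => [a b] [c d] [/= h1 h2] [/= h3 h4].
by rewrite (near_int h1 h3) (near_int h2 h4).
Qed.

Lemma open_square_off_curve C z p : open_square z p -> ~ curve C p.
Proof.
move=> zp [e _ /segmentE[/(open_square_uniq zp) + /(open_square_uniq zp)]].
by move=> <-; case: e => [[x y] []] /= [] /=; lia.
Qed.

Lemma sq_inj e f : sq1 f = sq1 e \/ sq1 f = sq2 e ->
  sq2 f = sq1 e \/ sq2 f = sq2 e -> f = e.
Proof.
by case: e f => [[x y] []] [[a b] []] /= [] [? ?] [] [? ?]; repeat congr pair; lia.
Qed.

(** Together with [sq_inj], this shows that the segment joining the two centres can meet no edge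
    other than [e]. *)
Lemma between_centers e w (t : R) : 0 <= t <= 1 ->
  closed_square w ((1 - t) *: center (sq1 e) + t *: center (sq2 e)) ->
  w = sq1 e \/ w = sq2 e.
Proof.
case: w e => [a b] [[x y] []] /andP[t0 t1] [/=]; rewrite !scale_regular.
all: rewrite !intrD !ler_norml => /andP[h1 h2] /andP[h3 h4].
- have h5 : b%:~R < (y + 2)%:~R :> R by rewrite intrD /=; lra.
  have h6 : y%:~R < b%:~R :> R by lra.
  have h7 : a%:~R < (x + 2)%:~R :> R by rewrite intrD /=; lra.
  have h8 : x%:~R < (a + 1)%:~R :> R by rewrite intrD /=; lra.
  move: h5 h6 h7 h8; rewrite !ltr_int => ? ? ? ?.
  have [->|->] : a = x \/ a = x + 1 by lia.
    by left; congr pair; lia.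
  by right; congr pair; lia.
- have h5 : a%:~R < (x + 2)%:~R :> R by rewrite intrD /=; lra.
  have h6 : x%:~R < a%:~R :> R by lra.
  have h7 : b%:~R < (y + 2)%:~R :> R by rewrite intrD /=; lra.
  have h8 : y%:~R < (b + 1)%:~R :> R by rewrite intrD /=; lra.
  move: h5 h6 h7 h8; rewrite !ltr_int => ? ? ? ?.
  have [->|->] : b = y \/ b = y + 1 by lia.
    by left; congr pair; lia.
  by right; congr pair; lia.
Qed.

(** The segment from [p] to the centre lies in the open square, which no edge meets, except possibly
    for its start [p], which is off the curve by hypothesis. *)
Lemma component_center C z p : closed_square z p -> ~ curve C p ->
  connected_component (~` curve C) p (center z).
Proof.
move=> zp nCp; apply: segment_component => t /andP[t0 t1].
have [->|tn0] := eqVneq t 0; first by rewrite subr0 scale1r scale0r addr0.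
have {}t0 : 0 < t by rewrite lt_neqAle eq_sym tn0.
apply: (@open_square_off_curve _ z); move: zp.
rewrite /closed_square /open_square /= !scale_regular !ler_norml !ltr_norml.
by move=> [/andP[h1 h2] /andP[h3 h4]]; split; apply/andP; split; nra.
Qed.

Lemma component_linked C z w p : closed_square z p -> ~ curve C p ->
  linked [set` C] z w -> connected_component (~` curve C) p (center w).
Proof.
move=> zp nCp zw.
apply: (zw [set w | connected_component (~` curve C) p (center w)]); last first.
  exact: component_center.
move=> e /= nCe.
have ee : connected_component (~` curve C) (center (sq1 e)) (center (sq2 e)).
  apply: segment_component => t t01 [f fC /segmentE[f1 f2]].
  have := sq_inj (between_centers t01 f1) (between_centers t01 f2).
  by move=> fe; rewrite fe in fC.
split=> h; apply: connected_component_trans h _ => //.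
exact: connected_component_sym.
Qed.

(** The squares differ by at most one in each coordinate, and the intermediate square [(c, b)]
    contains [p] too. An edge crossed on the way contains [p], hence is not in [C]. *)
Lemma linked_closed_squares C z w p : ~ curve C p ->
  closed_square z p -> closed_square w p -> linked [set` C] z w.
Proof.
have off e : ~ curve C p -> closed_square (sq1 e) p -> closed_square (sq2 e) p ->
    linked [set` C] (sq1 e) (sq2 e).
  by move=> nCp h1 h2; apply: linked_edge => eC; apply: nCp; exists e => //; apply/segmentE.
case: z w => [a b] [c d] nCp zp wp.
apply: (@linked_trans _ _ (c, b)).
  have cp : closed_square (c, b) p by case: zp wp => ? ? [].
  have : `|a - c| <= 1 by apply: near_ints zp.1 wp.1.
  move=> ac; have [|[]] : a = c \/ c = a + 1 \/ a = c + 1 by lia.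
  + by move=> ->; apply: linked_refl.
  + move=> ?; subst c; have := off ((a, b - 1), true) nCp.
    by rewrite /= subrK; apply.
  + move=> ?; subst a; apply: linked_sym; have := off ((c, b - 1), true) nCp.
    by rewrite /= subrK; apply.
have cp : closed_square (c, b) p by case: zp wp => ? ? [].
have : `|b - d| <= 1 by apply: near_ints zp.2 wp.2.
move=> rim; have [|[]] : b = d \/ d = b + 1 \/ b = d + 1 by lia.
+ by move=> ->; apply: linked_refl.
+ move=> ?; subst d; have := off ((c - 1, b), false) nCp.
  by rewrite /= subrK; apply.
+ move=> ?; subst b; apply: linked_sym; have := off ((c - 1, d), false) nCp.
  by rewrite /= subrK; apply.
Qed.

Lemma in_some_closed_square p : exists z, closed_square z p.
Proof.
exists (Num.floor (p.1 + 2^-1), Num.floor (p.2 + 2^-1)).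
have h (x : R) : `|x - (Num.floor (x + 2^-1))%:~R| <= 2^-1.
  have := floor_le_tmp (x + 2^-1); have := floorD1_gt (x + 2^-1).
  by rewrite intrD ler_norml /=; lra.
by split; apply: h.
Qed.

(** The closed unit intervals around the integers are locally finite, so only those containing [x]
    come near [x]. *)
Lemma near_closed_interval (x : R) : exists2 d : R, 0 < d &
  forall y, `|x - y| < d ->
    forall k : int, `|y - k%:~R| <= 2^-1 -> `|x - k%:~R| <= 2^-1.
Proof.
pose m := Num.floor (x + 2^-1).
have m1 : m%:~R <= x + 2^-1 by apply: floor_le_tmp.
have m2 : x + 2^-1 < m%:~R + 1.
  by have := floorD1_gt (x + 2^-1); rewrite intrD.
(* If [x] is the common end of the intervals around [m - 1] and [m], radius 1 reaches no third one.
   Otherwise [x] is inside the interval around [m], and the radius is the distance to its nearer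
   end. *)
have [mx|mx] := eqVneq (m%:~R - 2^-1) x.
  exists 1 => // y; rewrite ltr_norml => /andP[y1 y2] k.
  rewrite !ler_norml => /andP[k1 k2].
  have h1 : k%:~R < (m + 1)%:~R :> R by rewrite intrD /=; lra.
  have h2 : m%:~R < (k + 2)%:~R :> R by rewrite intrD /=; lra.
  move: h1 h2; rewrite !ltr_int => h1 h2.
  have [->|->] : k = m \/ k = m - 1 by lia.
    by lra.
  by rewrite intrD /=; lra.
exists (Num.min (m%:~R + 2^-1 - x) (x - (m%:~R - 2^-1))).
  by rewrite lt_min; apply/andP; split; first lra; rewrite subr_gt0 lt_neqAle mx; lra.
move=> y; rewrite lt_min !ltr_norml.
move=> /andP[/andP[y1 y2] /andP[y3 y4]] k; rewrite !ler_norml => /andP[k1 k2].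
have h1 : k%:~R < (m + 1)%:~R :> R by rewrite intrD /=; lra.
have h2 : m%:~R < (k + 1)%:~R :> R by rewrite intrD /=; lra.
move: h1 h2; rewrite !ltr_int => h1 h2.
have -> : k = m by lia.
lra.
Qed.

Lemma near_closed_square p :
  \forall q \near p, forall z, closed_square z q -> closed_square z p.
Proof.
have [d1 d1p h1] := near_closed_interval p.1.
have [d2 d2p h2] := near_closed_interval p.2.
apply/nbhs_ballP; exists (Num.min d1 d2) => /=; first by rewrite lt_min d1p.
move=> q [/= q1 q2] z [z1 z2]; split.
  by apply: h1 z1; apply: lt_le_trans q1 _; rewrite ge_min lexx.
by apply: h2 z2; apply: lt_le_trans q2 _; rewrite ge_min lexx orbT.
Qed.

Lemma component_sub_squares C z p : closed_square z p -> ~ curve C p ->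
  connected_component (~` curve C) p `<=`
  [set q | exists2 w, linked [set` C] z w & closed_square w q].
Proof.
move=> zp nCp; set A := [set q | _].
set X := connected_component _ _.
have XC : X `<=` ~` curve C by apply: connected_component_sub.
suff XA : X `&` A = X by rewrite -XA => q [].
apply: component_connected.
- exists p; split; first exact: connected_component_refl.
  by exists z.
(* Relatively open: a square containing a point near [q] also contains [q], hence is linked to
   [w]. *)
- exists A°; first exact: open_interior.
  apply/seteqP; split=> q [Xq Aq]; split=> //; last exact: interior_subset.
  have [w zw wq] := Aq.
  near=> r.
  have [v vr] := in_some_closed_square r.
  exists v => //; apply: linked_trans zw _.
  apply: (linked_closed_squares (XC _ Xq) wq).
  move: v vr; near: r; exact: near_closed_square.
(* Relatively closed: a point of [A] near [q] lies in a reachable square, and this square contains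
   [q] as well. *)
- exists (closure A); first exact: closed_closure.
  apply/seteqP; split=> q [Xq Aq]; split=> //; first exact: subset_closure.
  have [r [[w zw wr] h]] := Aq _ (near_closed_square q).
  by exists w => //; apply: h.
Unshelve. all: by end_near.
Qed.

Lemma norm_prod_ge1 p : `|p.1| <= `|p|.
Proof. by rewrite prod_normE le_max lexx. Qed.

(** The centres of all reachable squares lie in the component of [p]. *)
Lemma cycle_exterior_unbounded C z p : closed_square z p -> ~ curve C p ->
  (forall N : int, exists2 w, linked [set` C] z w & N < w.1) ->
  cycle_exterior C p.
Proof.
move=> zp nCp far; split=> // /pinfty_ex_gt0[M M0 bM].
have [w zw] := far (Num.floor M + 1).
have /= := bM _ (component_linked zp nCp zw).
have := floorD1_gt M.
move=> h1 h2 h3; have := le_trans (norm_prod_ge1 _) h2.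
rewrite /= ler_norml => /andP[_]; rewrite leNgt => /negP; apply.
by apply: lt_trans h1 _; rewrite ltr_int.
Qed.

Lemma cycle_interior_bounded C z p (N : int) : closed_square z p -> ~ curve C p ->
  (forall w, linked [set` C] z w -> `|w.1| <= N /\ `|w.2| <= N) ->
  cycle_interior C p.
Proof.
move=> zp nCp near; split=> //.
exists (N%:~R + 1); split; first exact: num_real.
move=> M NM q /(component_sub_squares zp nCp) [w /near[w1 w2] [q1 q2]] /=.
have {}w1 : `|w.1%:~R| <= N%:~R :> R by rewrite -intr_norm ler_int.
have {}w2 : `|w.2%:~R| <= N%:~R :> R by rewrite -intr_norm ler_int.
rewrite prod_normE ge_max; move: w1 w2 q1 q2 NM; rewrite !ler_norml => *.
apply/andP; split; lra.
Qed.

End Topology.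

(** * Cycles and components *)

(** Applied with [Q] the whole plane or the complement of the component. *)
Lemma linked_row (B : set edge) (Q : set square) (a m b : int) :
  (forall e, Q (sq1 e) -> Q (sq2 e) -> ~ B e) -> a <= m ->
  (forall k, a <= k <= m -> Q (k, b)) -> linked B (a, b) (m, b).
Proof.
move=> BQ; move: m; apply: int_up_ind => [_|m am IH Qm]; first exact: linked_refl.
apply: (@linked_trans _ _ (m, b)); first by apply: IH => k km; apply: Qm; lia.
have := @linked_edge B ((m, b - 1), true); rewrite /= subrK; apply.
by apply: BQ; rewrite /= subrK; apply: Qm; lia.
Qed.

Lemma linked_col (B : set edge) (Q : set square) (a b m : int) :
  (forall e, Q (sq1 e) -> Q (sq2 e) -> ~ B e) -> b <= m ->
  (forall k, b <= k <= m -> Q (a, k)) -> linked B (a, b) (a, m).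
Proof.
move=> BQ; move: m; apply: int_up_ind => [_|m am IH Qm]; first exact: linked_refl.
apply: (@linked_trans _ _ (a, m)); first by apply: IH => k km; apply: Qm; lia.
have := @linked_edge B ((a - 1, m), false); rewrite /= subrK; apply.
by apply: BQ; rewrite /= subrK; apply: Qm; lia.
Qed.

Lemma linked_set0 z w : linked set0 z w.
Proof.
have no e : setT (sq1 e) -> setT (sq2 e) -> ~ set0 e by move=> _ _ [].
have row a m b : linked set0 (a, b) (m, b).
  have [am|/ltW am] := leP a m; first exact: (linked_row no am).
  exact: linked_sym (linked_row no am _).
have col a b m : linked set0 (a, b) (a, m).
  have [am|/ltW am] := leP b m; first exact: (linked_col no am).
  exact: linked_sym (linked_col no am _).
case: z w => [a b] [c d]; exact: linked_trans (row a c b) (col c b d).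
Qed.

Lemma seq_neq0 (T : eqType) (s : seq T) : s != [::] -> exists x, x \in s.
Proof. by case: s => // x s _; exists x; rewrite mem_head. Qed.

Lemma mem_fset_of (s : seq edge) e : (e \in [fset f in s]%fset) = (e \in s).
Proof. by rewrite !inE. Qed.

Lemma mem_sep (E : {fset edge}) (P : pred edge) e :
  (e \in [fset f in E | P f]%fset) = (e \in E) && P e.
Proof. by rewrite !inE. Qed.

(** At each vertex [P] holds for all edges of [E] or for none, so the degree is that in [E] or
    zero. *)
Lemma even_closed_sub (E : {fset edge}) (P : pred edge) : even_edges E ->
  (forall e f v, e \in E -> f \in E -> P e -> v \in ends e -> v \in ends f ->
     P f) ->
  even_edges [fset e in E | P e]%fset.
Proof.
move=> evE clP v.
have [[e [eE Pe ve]]|none] :=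
    pselect (exists e, [/\ e \in E, P e & v \in ends e]).
  suff -> : deg [fset e in E | P e]%fset v = deg E v by apply: evE.
  rewrite !deg_star ?fset_uniq //; apply: eq_in_count => f.
  rewrite mem_star => vf /=; rewrite mem_sep.
  by apply: andb_idr => fE; apply: (clP e f v).
rewrite /deg (@eq_in_count _ _ pred0) ?count_pred0 // => e.
rewrite mem_sep => /andP[eE Pe]; apply/negP => ve; apply: none; by exists e.
Qed.

Lemma is_cycle_edges (G : set edge) (C : {fset edge}) :
  is_cycle G C -> [set` C] `<=` G.
Proof.
case=> c [[e1 [s [et [-> _ Get [_ _ sG] _]]]] Cc _] e /=.
by rewrite Cc mem_rcons inE => /predU1P[->|/sG].
Qed.

Lemma is_cycle_neq0 (G : set edge) (C : {fset edge}) :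
  is_cycle G C -> exists e, e \in C.
Proof.
case=> c [[e1 [s [et [-> _ _ _ _]]]] Cc _]; exists e1.
by rewrite Cc mem_rcons !inE eqxx orbT.
Qed.

Lemma is_cycle_deg (G : set edge) (C : {fset edge}) e v :
  is_cycle G C -> e \in C -> v \in ends e -> deg C v = 2%N.
Proof.
case=> c [[e1 [s [et [_ uc _ _ _]]]] Cc deg2] eC ve.
rewrite (eq_deg _ (fset_uniq C) uc Cc); apply: deg2; by exists e.
Qed.

Lemma is_cycle_even (G : set edge) (C : {fset edge}) :
  is_cycle G C -> even_edges C.
Proof.
move=> cC v; have [/hasP[e eC ve]|] := boolP (has (fun e => v \in ends e) C).
  by rewrite (is_cycle_deg cC eC ve).
by rewrite has_count -leqNgt leqn0 => /eqP; rewrite /deg => ->.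
Qed.

(** Successive edges of the circuit share a vertex and the last edge meets the first, so a predicate
    that spreads across vertices has a single value on it. *)
Lemma is_cycle_edge_connected (G : set edge) (C : {fset edge}) :
  is_cycle G C -> edge_connected C.
Proof.
case=> c [[e1 [s [et [cE _ _ [_ ps _] [u [v [_ uet _ ue1 _]]]]]]] Cc _].
move=> P [e0 e0C Pe0] clP.
have memC e : e \in C = (e \in e1 :: s) || (e == et).
  by rewrite Cc cE mem_rcons inE orbC.
have PE e f x : e \in C -> f \in C -> x \in ends e -> x \in ends f -> P e = P f.
  by move=> eC fC xe xf; apply/idP/idP => h; apply: clP h _ _; eauto.
have Ps e : e \in e1 :: s -> P e = P e1.
  have : {subset e1 :: s <= C} by move=> f fs; rewrite memC fs.
  elim: s e1 ps e {cE ue1 memC} => [|f s IH] e1 /=; first by move=> _ e _; rewrite inE => /eqP->.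
  case/andP=> /andP[_ /hasP[x xe1 xf]] ps e sC.
  rewrite inE => /predU1P[->//|es].
  rewrite (IH f) // => [|g gs]; last by apply: sC; rewrite inE gs orbT.
  by apply: (PE _ _ x) => //; apply: sC; rewrite !inE eqxx ?orbT.
have Pet : P et = P e1.
  by apply: (PE _ _ u) => //; rewrite memC ?inE ?eqxx ?orbT.
have PC e : e \in C -> P e = P e1 by rewrite memC => /orP[/Ps|/eqP->].
by move=> e eC; rewrite PC // -(PC _ e0C).
Qed.

Lemma sub_count_eq (T : eqType) (a b : pred T) (s : seq T) :
  subpred a b -> count a s = count b s -> {in s, a =1 b}.
Proof.
move=> ab; elim: s => //= x s IH eqc y.
have le1 : (a x <= b x)%N by case: (a x) (ab x) => // ->.
have le2 : (count a s <= count b s)%N by apply: sub_count.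
have [e1 e2] : a x = b x :> nat /\ count a s = count b s by lia.
rewrite inE => /predU1P[->|/IH]; last exact.
by move: e1; case: (a x); case: (b x).
Qed.

(** At a vertex of [C] both cycles have degree 2, so [D] has no further edge there; connectedness of
    [D] then spreads [C] over all of [D]. *)
Lemma is_cycle_sub (G H : set edge) (C D : {fset edge}) :
  is_cycle G C -> is_cycle H D -> {subset C <= D} -> C = D.
Proof.
move=> cC cD CD; have [e0 e0C] := is_cycle_neq0 cC.
apply/fsetP => e; apply/idP/idP => [/CD//|]; move: e.
apply: (is_cycle_edge_connected cD (P := mem C)); first by exists e0 => //; apply: CD.
move=> e f v eD fD /= eC ve vf.
have := is_cycle_deg cD eD ve; rewrite -(is_cycle_deg cC eC ve).
rewrite !deg_star ?fset_uniq // => /esym/sub_count_eq-/(_ CD f).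
by rewrite mem_star => /(_ vf) /= ->.
Qed.

Lemma star_adj_sides e : star_adj (sq1 e) (sq2 e) /\ star_adj (sq2 e) (sq1 e).
Proof.
case: e => [[x y] d]; rewrite /star_adj; split; apply/andP; split.
1,3: by case: d; rewrite /= xpair_eqE; lia.
all: by apply/hasP; exists (x, y); case: d; rewrite /= !inE !xpair_eqE; lia.
Qed.

Section Component.
Variable occ : set square.
Hypothesis occ0 : occ (0, 0).
Local Notation K := (component occ).

Lemma component_origin : K (0, 0).
Proof. by exists [::]; split=> // y; rewrite inE => /eqP->. Qed.

Lemma component_step z w : K z -> occ w -> star_adj z w -> K w.
Proof.
case=> s [us os ps lz] ow zw.
have ps' : path star_adj (0, 0) (rcons s w) by rewrite rcons_path ps lz.
have lw : last (0, 0) (rcons s w) = w by rewrite last_rcons.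
have os' y : y \in (0, 0) :: rcons s w -> occ y.
  by rewrite -rcons_cons mem_rcons inE => /predU1P[->|/os].
(* The square [w] may already occur on the path, so the extended path is shortened to one without
   repetition. *)
rewrite -[X in K X]lw; case/shortenP: ps' => t pt ut st.
exists t; split=> // y; rewrite inE => /predU1P[->//|/st yt].
by apply: os'; rewrite inE yt orbT.
Qed.

Lemma component_ind (P : set square) : P (0, 0) ->
  (forall z w, K z -> K w -> star_adj z w -> P z -> P w) ->
  forall z, K z -> P z.
Proof.
move=> P0 PS _ [s [us os ps <-]].
elim/last_ind: s us os ps => [//|s x IH]; rewrite last_rcons.
rewrite -rcons_cons rcons_uniq rcons_path => /andP[_ us] os /andP[ps sx].
have os' y : y \in (0, 0) :: s -> occ y.
  by move=> ys; apply: os; rewrite mem_rcons inE ys orbT.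
have Kl : K (last (0, 0) s) by exists s.
apply: (PS (last (0, 0) s)) => //; last exact: IH.
by apply: component_step Kl _ sx; apply: os; rewrite mem_rcons mem_head.
Qed.

End Component.

(** * The rim and its loops *)

Section OuterBoundary.
Variables (occ : set square) (Ks : seq square) (N : int).
Hypothesis occ0 : occ (0, 0).
Local Notation K := (component occ).
Local Notation G := (G0 occ).
Hypothesis KsE : forall z, K z <-> z \in Ks.
Hypothesis KN : forall z, K z -> `|z.1| <= N /\ `|z.2| <= N.

Lemma G0E e : G e <-> K (sq1 e) \/ K (sq2 e).
Proof.
split=> [[z Kz]|]; first by rewrite mem_sides => /orP[]/eqP <-; [left|right].
by case=> Kz; eexists; eauto; rewrite mem_sides eqxx ?orbT.
Qed.

Lemma G0_closed e : ~ K (sq1 e) -> ~ K (sq2 e) -> ~ G e.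
Proof. by rewrite G0E => ? ? []. Qed.

Definition far : square := (N + 1, 0).

(* [far] lies outside the box containing the component, so this is the
   unbounded part of the complement. *)
Definition outer : set square := [set z | linked G far z].

Lemma outer_component z : outer z -> ~ K z.
Proof.
move=> oz; apply: (oz (~` K)) => /= [e|/KN /=]; last by lia.
by rewrite G0E; tauto.
Qed.

(** Column [N + 1] and all rows above and below the box are joined to [far] outside the box. Squares
    to the right of the box are reached along their row, those to its left along their column from
    row [N + 1]. *)
Lemma outer_far z : N < `|z.1| \/ N < `|z.2| -> outer z.
Proof.
have N0 : 0 <= N by have [] := KN (component_origin occ0).
have row a m b : a <= m -> (forall k, a <= k <= m -> N < `|k| \/ N < `|b|) ->
    linked G (a, b) (m, b).
  move=> am out; apply: (linked_row (Q := ~` K) G0_closed am) => k /out h /KN /=; lia.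
have col a b m : b <= m -> (forall k, b <= k <= m -> N < `|a| \/ N < `|k|) ->
    linked G (a, b) (a, m).
  move=> am out; apply: (linked_col (Q := ~` K) G0_closed am) => k /out h /KN /=; lia.
have colr b : linked G far (N + 1, b).
  have [b0|/ltW b0] := leP 0 b; first by apply: col => // k; lia.
  by apply: linked_sym; apply: col => // k; lia.
have rowfar a b : N < `|b| -> outer (a, b).
  move=> bN; apply: linked_trans (colr b) _.
  have [aN|/ltW aN] := leP a (N + 1); first by apply: linked_sym; apply: row => // k; lia.
  by apply: row => // k; lia.
case: z => a b /= [aN|/rowfar//].
have [bN|Nb] := ltP N b; first by apply: rowfar; lia.
have [a0|a0] := leP 0 a.
  by apply: linked_trans (colr b) _; apply: row => [|k]; lia.
apply: linked_trans (rowfar a (N + 1) _) _; first by lia.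
by apply: linked_sym; apply: col => [|k]; lia.
Qed.

Lemma inner_bounded z : ~ outer z -> `|z.1| <= N /\ `|z.2| <= N.
Proof. by move=> nz; split; rewrite leNgt; apply/negP => ?; apply: nz; apply: outer_far; auto.
Qed.

Definition rim : set edge := [set e | ~ (outer (sq1 e) <-> outer (sq2 e))].

Lemma rim_G0 : rim `<=` G.
Proof. by move=> e; apply: contra_notP => nGe; apply: linked_closed. Qed.

(** A rim edge is a side of a square of the component; that square is not outer, so the other one
    is. *)
Lemma rimP e : rim e -> exists o i, [/\ outer o, K i &
  sq1 e = o /\ sq2 e = i \/ sq1 e = i /\ sq2 e = o].
Proof.
move=> be; have /G0E Ke := rim_G0 be; move: be; rewrite /rim /=.
have := @outer_component (sq1 e); have := @outer_component (sq2 e).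
move=> h2 h1 ne.
have [p1|p1] := pselect (outer (sq1 e)); have [p2|p2] := pselect (outer (sq2 e)).
- tauto.
- by exists (sq1 e), (sq2 e); split; tauto.
- by exists (sq2 e), (sq1 e); split; tauto.
- tauto.
Qed.

Local Notation L := (linked rim).

Lemma same_outer z w : L z w -> (outer z <-> outer w).
Proof.
move=> zw; have h x y : L x y -> outer x -> outer y.
  by move/(_ outer); apply=> e /contrapT.
by split; apply: h => //; apply: linked_sym.
Qed.

Lemma outer_linked z w : outer z -> outer w -> L z w.
Proof.
move=> oz ow; apply: (linked_sub rim_G0).
exact: linked_trans (linked_sym oz) ow.
Qed.

Definition component_sides : seq edge := flatten [seq sides z | z <- Ks].

Lemma mem_component_sides e : e \in component_sides <-> G e.
Proof.
split=> [/flatten_mapP[z /KsE Kz ez]|[z /KsE Kz ez]]; first by exists z.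
by apply/flatten_mapP; exists z.
Qed.

Definition rim_fset : {fset edge} := [fset e in component_sides | `[< rim e >]]%fset.

Lemma mem_rim_fset e : e \in rim_fset <-> rim e.
Proof.
rewrite !inE /=; split=> [/andP[_ /asboolP//]|be].
by rewrite asboolT // andbT; apply/mem_component_sides/rim_G0.
Qed.

(* The boundary of the region of [z]; meaningful for [z] not [outer]. *)
Definition loop z : {fset edge} :=
  [fset e in component_sides | `[< rim e /\ (L z (sq1 e) \/ L z (sq2 e)) >]]%fset.

Lemma mem_loop z e : e \in loop z <-> rim e /\ (L z (sq1 e) \/ L z (sq2 e)).
Proof.
rewrite !inE /=; split=> [/andP[_ /asboolP//]|be].
by rewrite asboolT // andbT; apply/mem_component_sides/rim_G0; case: be.
Qed.

Lemma loop_rim z e : e \in loop z -> rim e. Proof. by case/mem_loop. Qed.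

Lemma loop_G0 z : [set` loop z] `<=` G.
Proof. by move=> e /loop_rim/rim_G0. Qed.

(** One side of a rim edge is outer and so never in the region of [z]. This presents the loop as a
    cut, to which [even_cut] applies. *)
Lemma mem_loop_xor z e : ~ outer z ->
  (e \in loop z) = `[< L z (sq1 e) >] (+) `[< L z (sq2 e) >].
Proof.
move=> nz; apply/idP/idP => [/mem_loop[be]|].
  have := @same_outer z (sq1 e); have := @same_outer z (sq2 e).
  case: asboolP => h1; case: asboolP => h2 //= s2 s1; last by case.
  by move: be; rewrite /rim /=; have := s2 h2; have := s1 h1; tauto.
move=> h; apply/mem_loop; split; last first.
  by move: h; case: asboolP => h1; case: asboolP => h2; auto.
apply: contraPP h => /(linked_closed z) h.
by rewrite (asbool_equiv_eq h) addbb.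
Qed.

Lemma loop_inner z e : ~ outer z -> e \in loop z ->
  exists o i, [/\ outer o, K i, L z i &
    sq1 e = o /\ sq2 e = i \/ sq1 e = i /\ sq2 e = o].
Proof.
move=> nz /mem_loop[/rimP[ o [ i [ oo Ki eoi]]] Lz].
exists o, i; split=> //.
have nLo : ~ L z o by move=> /same_outer; tauto.
by case: eoi Lz => -[-> ->]; tauto.
Qed.

Lemma loop_eq z w : L z w -> loop z = loop w.
Proof.
move=> zw; apply/fsetP => e.
have h x : L z x <-> L w x.
  by split; apply: linked_trans => //; apply: linked_sym.
by apply/idP/idP => /mem_loop; rewrite ?h => ?; apply/mem_loop; rewrite ?h.
Qed.

Lemma loop_even z : ~ outer z -> even_edges (loop z).
Proof.
by move=> nz; apply: (even_cut (P := fun w => `[< L z w >])) => e; apply: mem_loop_xor.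
Qed.

(** With an empty loop the region of [z] would spread over the whole plane and contain [far]. *)
Lemma loop_neq0 z : ~ outer z -> exists e, e \in loop z.
Proof.
move=> nz; apply: contrapT => none; apply: (nz).
suff zf : L z far by apply/(same_outer zf); exact: linked_refl.
apply: (@linked_set0 z far (linked rim z)) => [e _|]; last exact: linked_refl.
have /negbTE ez : e \notin loop z by apply/negP => ez; apply: none; exists e.
have := mem_loop_xor e nz; rewrite ez.
by case: asboolP => ?; case: asboolP => ?.
Qed.

(** An edge of the loop of [z] separates the region of [z] from [outer], where the potential
    vanishes. Its membership in [D] thus depends on [z] alone: [D] contains all of a loop or nothing
    of it. *)
Lemma rim_potential (D : {fset edge}) : even_edges D -> [set` D] `<=` rim ->
  exists n : square -> bool,
    forall z e, ~ outer z -> e \in loop z -> (e \in D) = n z.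
Proof.
move=> evD Dbd; have [n [nD [M nM]]] := even_potential evD.
have nL z w : L z w -> n z = n w.
  move=> zw; apply: (zw [set w | n z = n w]) => // e nbe /=.
  have : e \notin D by apply/negP => /Dbd.
  by rewrite nD; case: (n (sq1 e)); case: (n (sq2 e)).
have no z : outer z -> n z = false.
  (* Beyond both [N] and [M], the square [(x, 0)] is outer and has potential zero. *)
  move=> oz; pose x := `|N| + `|M| + 1.
  rewrite (nL _ (x, 0)) ?nM /x //; first by lia.
  by apply: outer_linked => //; apply: outer_far; left => /=; lia.
exists n => z e nz ez.
have [ o [i [ oo Ki zi]]] := loop_inner nz ez.
by rewrite nD (nL _ _ zi) => -[] [-> ->]; rewrite (no _ oo) ?addbF.
Qed.

Lemma loop_edge_connected z : ~ outer z -> edge_connected (loop z).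
Proof.
move=> nz P [e0 e0z Pe0] clP e ez.
have [|n nz'] := rim_potential (even_closed_sub (loop_even nz) clP).
  by move=> f /=; rewrite mem_sep => /andP[fz _]; exact: (loop_rim fz).
have := nz' _ _ nz e0z; rewrite mem_sep e0z Pe0 => /esym n1.
by have := nz' _ _ nz ez; rewrite mem_sep ez n1.
Qed.

Lemma loop_trail z e v : ~ outer z -> e \in loop z -> v \in ends e ->
  exists s, closed_trail (loop z) v s.
Proof.
move=> nz ez ve.
have n0 : loop z != fset0 by apply/fset0Pn; exists e.
have [u [s us]] := euler n0 (loop_even nz) (loop_edge_connected nz).
exact: closed_trail_rot us ez ve.
Qed.

Lemma loop_deg z e v : ~ outer z -> e \in loop z -> v \in ends e ->
  deg (loop z) v = 2%N.
Proof.
move=> nz ez ve; have [s [ws cs us sE]] := loop_trail nz ez ve.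
have := loop_even nz v.
have : (0 < deg (loop z) v)%N by rewrite /deg -has_count; apply/hasP; exists e.
rewrite -(eq_deg v us (fset_uniq _) sE).
have [|] := leqP (deg s v) 2; first by case: (deg s v) => [|[|[|]]].
(* The trail starts and ends at [v]; a third incidence splits it into two nonempty closed trails,
   and the first is an even set containing some but not all of the loop. *)
move=> gt2; have [|s1 [s2 [def_s s1n s2n s1v]]] := @walk_revisit v s v ws.
  by rewrite cs eqxx.
move: us sE ws; rewrite def_s walk_cat cat_uniq => /and3P[us1 dis _] sE /andP[w1 _].
pose D : {fset edge} := [fset e in s1]%fset.
have DE f : (f \in D) = (f \in s1) by exact: mem_fset_of.
have evD : even_edges D.
  by move=> x; rewrite (eq_deg x (fset_uniq _) us1 DE) (odd_deg_walk _ w1) s1v addbb.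
have [|n nz'] := rim_potential evD.
  by move=> f /=; rewrite DE => fs; apply: (@loop_rim z); rewrite -sE mem_cat fs.
have [f1 fs1] := seq_neq0 s1n; have [f2 fs2] := seq_neq0 s2n.
have f1z : f1 \in loop z by rewrite -sE mem_cat fs1.
have f2z : f2 \in loop z by rewrite -sE mem_cat fs2 orbT.
have /hasPn/(_ _ fs2) := dis; rewrite /= -DE (nz' _ _ nz f2z).
by rewrite -(nz' _ _ nz f1z) DE fs1.
Qed.

Lemma loop_cycle z : ~ outer z -> is_cycle G (loop z).
Proof.
move=> nz; have [e ez] := loop_neq0 nz.
have n0 : loop z != fset0 by apply/fset0Pn; exists e.
have [u [s us]] := euler n0 (loop_even nz) (loop_edge_connected nz).
exists s; split; first exact: closed_trail_circuit n0 (@loop_G0 z) us.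
  by case: us => _ _ _ h f; rewrite h.
move=> v [f /= fz vf].
have [_ _ us' sE] := us.
by rewrite -/(deg s v) (eq_deg v us' (fset_uniq _) sE) (loop_deg nz fz vf).
Qed.

Lemma inner_component z : K z -> ~ outer z.
Proof. by move=> Kz /outer_component. Qed.

Lemma inner_side_uniq e o i o' i' :
  outer o -> outer o' -> K i -> K i' ->
  sq1 e = o /\ sq2 e = i \/ sq1 e = i /\ sq2 e = o ->
  sq1 e = o' /\ sq2 e = i' \/ sq1 e = i' /\ sq2 e = o' -> i' = i.
Proof.
move=> oo oo' /inner_component ni /inner_component ni'.
case=> -[e1 e2] [] [e3 e4]; move: ni ni' oo oo'; rewrite -?e1 -?e2 -?e3 -?e4 //.
Qed.

Lemma loop_disjoint z w e : ~ outer z -> ~ outer w ->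
  e \in loop z -> e \in loop w -> loop z = loop w.
Proof.
move=> nz nw ez ew; apply: loop_eq.
have [ o [i [ oo Ki zi eoi]]] := loop_inner nz ez.
have [ o' [i' [ oo' Ki' wi eoi']]] := loop_inner nw ew.
suff ii : i' = i by rewrite ii in wi; apply: linked_trans zi _; exact: linked_sym.
exact: inner_side_uniq eoi eoi'.
Qed.

Lemma loop_common_vertex z w u v : ~ outer z -> ~ outer w -> loop z != loop w ->
  on_graph [set` loop z] u -> on_graph [set` loop w] u ->
  on_graph [set` loop z] v -> on_graph [set` loop w] v -> u = v.
Proof.
move=> nz nw zw [e1 /= e1z ue1] [e2 /= e2w ue2] [f1 /= f1z vf1] [f2 /= f2w vf2].
apply/eqP/negPn/negP => uv.
have [s [ws _ us sE]] := loop_trail nz e1z ue1.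
have [t [wt _ ut tE]] := loop_trail nw e2w ue2.
rewrite -sE in f1z; rewrite -tE in f2w.
have [s1 [s2 [def_s s1v]]] := walk_visit ws f1z vf1.
have [t1 [t2 [def_t t1v]]] := walk_visit wt f2w vf2.
have s1z f : f \in s1 -> f \in loop z by rewrite -sE def_s mem_cat => ->.
have t1w f : f \in t1 -> f \in loop w by rewrite -tE def_t mem_cat => ->.
have ws1 : walk u s1 by move: ws; rewrite def_s walk_cat => /andP[].
have wt1 : walk u t1 by move: wt; rewrite def_t walk_cat => /andP[].
have us1 : uniq s1 by move: us; rewrite def_s cat_uniq => /and3P[].
have ut1 : uniq t1 by move: ut; rewrite def_t cat_uniq => /and3P[].
have notboth f : f \in loop z -> f \in loop w -> False.
  by move=> fz fw; move/eqP: zw; apply; apply: loop_disjoint fz fw.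
have ust : uniq (s1 ++ t1).
  rewrite cat_uniq us1 ut1 andbT; apply/hasPn => f /t1w fw /=.
  by apply/negP => /s1z fz; apply: notboth fz fw.
(* Both arcs lead from [u] to [v], so their disjoint union is even. *)
pose D : {fset edge} := [fset e in s1 ++ t1]%fset.
have DE f : (f \in D) = (f \in s1 ++ t1) by exact: mem_fset_of.
have evD : even_edges D.
  move=> x; rewrite (eq_deg x (fset_uniq _) ust DE) /deg count_cat oddD.
  by rewrite (odd_deg_walk _ ws1) (odd_deg_walk _ wt1) s1v t1v addbb.
have [|n nz'] := rim_potential evD.
  by move=> f /=; rewrite DE mem_cat => /orP[/s1z fz|/t1w fw]; [exact: (loop_rim fz)|exact: (loop_rim fw)].
have Dz f : f \in loop z -> (f \in s1) = n z.
  move=> fz; rewrite -(nz' z f nz fz) DE mem_cat.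
  by case: (boolP (f \in t1)) => [/t1w/(notboth _ fz)//|]; rewrite orbF.
have s1nil : s1 != [::].
  by apply: contraNneq uv => s1nil; rewrite -s1v s1nil.
have nz1 : n z.
  by have [f fs1] := seq_neq0 s1nil; rewrite -(Dz f) // s1z.
have s1E : s1 =i loop z.
  by move=> f; apply/idP/idP => [/s1z//|fz]; rewrite (Dz _ fz).
(* The arc [s1] is now the whole loop, yet it ends at [v] and not at [u], which makes the degree at
   [u] odd. *)
have := loop_even nz u; rewrite -(eq_deg u us1 (fset_uniq _) s1E).
by rewrite (odd_deg_walk _ ws1) s1v eqxx (negbTE uv).
Qed.

Lemma mem_corners (z : square) (v : vertex) : v \in corners z ->
  [\/ z = v, z = (v.1 + 1, v.2), z = (v.1, v.2 + 1) | z = (v.1 + 1, v.2 + 1)].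
Proof.
case: z v => [a b] [x y]; rewrite !inE !xpair_eqE /=.
case/or4P => /andP[/eqP-> /eqP->]; rewrite ?subrK; by [constructor 4|constructor 3|constructor 1|constructor 2].
Qed.

(** If no loop edge ended at [v], the four squares around [v] would all be in the region of [z] or
    all outside it. *)
Lemma loop_at_corner z w v : ~ outer z -> v \in corners z -> v \in corners w ->
  ~ L z w -> exists2 e, e \in loop z & v \in ends e.
Proof.
move=> nz vz vw; apply: contra_notP => none.
have none' e : v \in ends e -> L z (sq1 e) <-> L z (sq2 e).
  move=> ve; have : e \notin loop z by apply/negP => ez; apply: none; exists e.
  by rewrite (mem_loop_xor e nz); case: asboolP => ?; case: asboolP => ?.
case: v vz vw {none} none' => x y vz vw none'.
have := none' ((x, y), false); have := none' ((x - 1, y), false).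
have := none' ((x, y), true); have := none' ((x, y - 1), true).
rewrite /= !subrK !inE !xpair_eqE ?subrK !eqxx /= ?orbT => h1 h2 h3 h4.
have {}h1 := h1 isT; have {}h2 := h2 isT; have {}h3 := h3 isT; have {}h4 := h4 isT.
have zz := @linked_refl rim z.
by case: (mem_corners vz) => /= zE; rewrite {2}zE in zz;
  case: (mem_corners vw) => /= ->; tauto.
Qed.

Lemma rim_even : even_edges rim_fset.
Proof.
apply: (even_cut (P := fun w => `[< outer w >])) => e.
apply/idP/idP => [/mem_rim_fset|].
  by rewrite /rim /=; case: asboolP => ?; case: asboolP => ? //; tauto.
by case: asboolP => ?; case: asboolP => ? // _; apply/mem_rim_fset; rewrite /rim /=; tauto.
Qed.

(** [P] has one value on each loop. Star adjacent squares of the component lie in the same region,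
    or both their loops have an edge at the common corner; so the value is the same for all
    loops. *)
Lemma rim_edge_connected : edge_connected rim_fset.
Proof.
move=> P [e0 e0B Pe0] clP.
have [|n nz] := rim_potential (even_closed_sub rim_even clP).
  by move=> f /=; rewrite mem_sep => /andP[/mem_rim_fset].
have nP z e : K z -> e \in loop z -> P e = n z.
  move=> Kz ez; rewrite -(nz z e (inner_component Kz) ez) mem_sep.
  by have /mem_rim_fset -> := loop_rim ez.
have nK z : K z -> n z = n (0, 0).
  move: z; apply: (component_ind occ0) => // z w Kz Kw /andP[_ /hasP[v vz vw]] <-.
  have [zw|nzw] := pselect (L z w).
    have [e ez] := loop_neq0 (inner_component Kz).
    by rewrite -(nP z e) // (nP w e) // -(loop_eq zw).
  have [e ez ve] := loop_at_corner (inner_component Kz) vz vw nzw.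
  have [|f fw vf] := loop_at_corner (inner_component Kw) vw vz.
    by move=> /linked_sym.
  have eB : e \in rim_fset by apply/mem_rim_fset/(loop_rim ez).
  have fB : f \in rim_fset by apply/mem_rim_fset/(loop_rim fw).
  rewrite -(nP z e) // -(nP w f) //; apply/idP/idP => h.
    exact: clP fB eB h vf ve.
  exact: clP eB fB h ve vf.
have nBE e : e \in rim_fset -> P e = n (0, 0).
  move=> /[dup] eB /mem_rim_fset/rimP[ o [ i [ oo Ki eoi]]].
  rewrite -(nK i Ki); apply: nP => //; apply/mem_loop; split; first exact/mem_rim_fset.
  by case: eoi => -[-> ->]; [right|left]; apply: linked_refl.
by move=> e /nBE ->; rewrite -(nBE _ e0B).
Qed.

Lemma rim_in_loop e : rim e -> exists2 z, K z & e \in loop z.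
Proof.
move=> /[dup] be /rimP[ o [ i [ oo Ki eoi]]]; exists i => //; apply/mem_loop; split=> //.
by case: eoi => -[-> ->]; [right|left]; apply: linked_refl.
Qed.

(** The cycle contains the whole loop of any of its edges, and nested cycles coincide. *)
Lemma cycle_in_rim (H : set edge) (C : {fset edge}) : H `<=` rim ->
  is_cycle H C -> exists2 z, K z & C = loop z.
Proof.
move=> Hbd cC; have [e eC] := is_cycle_neq0 cC.
have Cbd : [set` C] `<=` rim by move=> f /(is_cycle_edges cC)/Hbd.
have [z Kz ez] := rim_in_loop (Cbd _ eC).
have [n nz] := rim_potential (is_cycle_even cC) Cbd.
exists z => //; apply/esym.
apply: is_cycle_sub (loop_cycle (inner_component Kz)) cC _ => f fz.
by rewrite (nz z f (inner_component Kz) fz) -(nz z e (inner_component Kz) ez).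
Qed.

(** Leave the region of [w] through an edge of its own loop; the only inner side of that edge is not
    linked to [z], so it is not on the loop of [z]. *)
Lemma outside_loop z w o : ~ outer z -> ~ L z w -> outer o ->
  linked [set` loop z] w o.
Proof.
move=> nz nzw oo.
have lG : [set` loop z] `<=` rim by move=> e ez; exact: (loop_rim ez).
have oo' x : outer x -> linked [set` loop z] x o.
  move=> ox; apply: (linked_sub lG); exact: outer_linked.
have [//|nw] := pselect (outer w); first exact: oo'.
have [e ew] := loop_neq0 nw.
have [x [i [ox Ki wi exi]]] := loop_inner nw ew.
have nez : ~ [set` loop z] e.
  move=> /= ez; apply: nzw.
  have [x' [i' [ox' Ki' zi' exi']]] := loop_inner nz ez.
  suff ii : i' = i by rewrite ii in zi'; apply: linked_trans zi' _; exact: linked_sym.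
  exact: inner_side_uniq exi exi'.
apply: linked_trans (linked_sub lG wi) _.
apply: linked_trans (oo' _ ox).
by case: exi => -[<- <-]; [apply: linked_sym|]; apply: linked_edge.
Qed.

End OuterBoundary.

(** * The boundary cycles *)

Section Geometry.
Variables (R : realType) (occ : set square) (Ks : seq square) (N : int).
Hypothesis occ0 : occ (0, 0).
Local Notation K := (component occ).
Local Notation G := (G0 occ).
Hypothesis KsE : forall z, K z <-> z \in Ks.
Hypothesis KN : forall z, K z -> `|z.1| <= N /\ `|z.2| <= N.
Local Notation outer := (outer occ N).
Local Notation rim := (rim occ N).
Local Notation loop := (loop occ Ks N).
Local Notation L := (linked rim).

Lemma in_exterior_outer (C : {fset edge}) z o : [set` C] `<=` G ->
  outer o -> linked [set` C] z o -> in_exterior R C z.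
Proof.
move=> CG oo zo p zp.
apply: (cycle_exterior_unbounded (open_closed_square zp)).
  exact: open_square_off_curve zp.
move=> M; pose x := `|M| + `|N| + 1; exists (x, 0); last by rewrite /x /=; lia.
apply: linked_trans zo _.
apply: (linked_sub CG); apply: linked_trans (linked_sym oo) _.
by apply: (outer_far occ0 KN); left; rewrite /x /=; lia.
Qed.

(** Without crossing its loop one stays in the region of [z], which lies in the box. *)
Lemma in_interior_loop z : ~ outer z -> in_interior R (loop z) z.
Proof.
move=> nz p zp; apply: (cycle_interior_bounded (N := N) (open_closed_square zp)).
  exact: open_square_off_curve zp.
move=> w zw; apply: (inner_bounded occ0 KN).
have : L z w.
  apply: (zw (L z)) => [e /= nez|]; last exact: linked_refl.
  have /negP/negbTE := nez; rewrite (mem_loop_xor KsE e nz).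
  by case: asboolP => ?; case: asboolP => ?.
by move/same_outer; tauto.
Qed.

Lemma interior_exterior (C : {fset edge}) z :
  in_interior R C z -> ~ in_exterior R C z.
Proof.
move=> int ext; have zz := @open_square_center R z.
by have [_ +] := ext _ zz; have [_] := int _ zz.
Qed.

Lemma interior_in_class z w p : ~ outer z -> closed_square w p ->
  cycle_interior (R := R) (loop z) p -> L z w.
Proof.
move=> nz wp [nCp bnd]; apply: contrapT => nzw.
have [_] : cycle_exterior (loop z) p.
  apply: (cycle_exterior_unbounded wp nCp).
  move=> M; pose x := `|M| + `|N| + 1; exists (x, 0); last by rewrite /x /=; lia.
  apply: (outside_loop KsE KN nz nzw).
  by apply: (outer_far occ0 KN); left; rewrite /x /=; lia.
by apply.
Qed.

(** An edge off the rim fails the test against the loop of a component square [z] having it as a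
    side, as [z] is in the interior. A rim edge not on [C] can be crossed from its inner to its
    outer side, so both sides are exterior to [C]. *)
Lemma outermost_boundaryE : outermost_boundary R occ = rim.
Proof.
apply/seteqP; split=> e.
  move=> [Ge out]; apply: contrapT => nbe.
  have [z [Kz ez]] : exists z, K z /\ e \in sides z by case: Ge => z; exists z.
  have nz := inner_component KN Kz.
  have [/(mem_loop N KsE)[]//|ext] := out _ (loop_cycle occ0 KsE KN nz).
  exact: interior_exterior (in_interior_loop nz) (ext _ ez).
move=> be; split=> [|C cC]; first exact: rim_G0 be.
have CG := is_cycle_edges cC.
have [eC|/negP neC] := boolP (e \in C); [by left|right=> z].
have [ o [i [ oo Ki eoi]]] := rimP KN be.
have io : linked [set` C] i o.
  by case: eoi => -[<- <-]; [apply: linked_sym|]; apply: linked_edge.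
rewrite mem_sides => ez; apply: (in_exterior_outer CG oo).
have [->|->] : z = o \/ z = i; last exact: io; last exact: linked_refl.
by move: ez; case: eoi => -[-> ->] /orP[]/eqP; auto.
Qed.

Definition loops : {fset {fset edge}} := [fset loop z | z in Ks]%fset.

Lemma mem_loops (C : {fset edge}) :
  C \in loops <-> exists2 z, K z & C = loop z.
Proof.
split=> [/imfsetP[z /= /KsE Kz ->]|[z /KsE Kz ->]]; first by exists z.
by apply/imfsetP; exists z.
Qed.

Lemma loops_union : subgraph_union loops = rim.
Proof.
apply/seteqP; split=> e.
  by move=> [C /mem_loops[z Kz ->] ez]; exact: (loop_rim KsE ez).
move=> be; have [z Kz ez] := rim_in_loop KsE KN be.
by exists (loop z) => //; apply/mem_loops; exists z.
Qed.

Lemma loops_boundary_cycles : boundary_cycles R occ loops.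
Proof.
have rim_fsetE : [set` rim_fset occ Ks N] = rim.
  by apply/seteqP; split=> e /= /(mem_rim_fset N KsE).
split.
- by move=> C /mem_loops[z Kz ->]; exact: (loop_cycle occ0 KsE KN (inner_component KN Kz)).
- by rewrite outermost_boundaryE loops_union.
- by move=> e; rewrite outermost_boundaryE loops_union.
- rewrite loops_union; split; first exact: rim_G0.
  by rewrite -rim_fsetE; apply: edge_connected_is_connected; exact: rim_edge_connected.
- move=> C D /mem_loops[z Kz ->] /mem_loops[w Kw ->] zw.
  have nz := inner_component KN Kz; have nw := inner_component KN Kw.
  split; last by move=> u v uz uw vz vw; apply: (loop_common_vertex occ0 KsE KN nz nw zw).
  rewrite -subset0 => p [pz pw]; move/eqP: zw; apply.
  (* A square containing a common interior point is linked to both [z] and [w]. *)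
  have [x xp] := in_some_closed_square p.
  apply: loop_eq => //; apply: linked_trans (interior_in_class nz xp pz) _.
  exact: linked_sym (interior_in_class nw xp pw).
- move=> z Kz; exists (loop z); first by apply/mem_loops; exists z.
  exact: (in_interior_loop (inner_component KN Kz)).
- move=> C e /mem_loops[z Kz ->] ez; have nz := inner_component KN Kz.
  have [ o [i [ oo Ki zi eoi]]] := loop_inner KsE KN nz ez.
  have eo : e \in sides o by rewrite mem_sides; case: eoi => -[-> ->]; rewrite eqxx ?orbT.
  have ei : e \in sides i by rewrite mem_sides; case: eoi => -[-> ->]; rewrite eqxx ?orbT.
  have vo : ~ occ o.
    (* If occupied, [o] would join the component through its star adjacent square [i]. *)
    move=> occo; apply: (outer_component KN oo); apply: (component_step occ0 Ki occo).
    have [s12 s21] := star_adj_sides e.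
    by case: eoi => -[e1 e2]; rewrite -?e1 -?e2.
  split.
  + by split; [exists o|exists i].
  + exists i; split=> //; rewrite (loop_eq KsE zi).
    exact: (in_interior_loop (inner_component KN Ki)).
  + exists o; split=> // D /mem_loops[w Kw ->].
    apply: (in_exterior_outer _ oo); last exact: linked_refl.
    exact: loop_G0.
Qed.

Lemma loops_unique (Cs : {fset {fset edge}}) :
  boundary_cycles R occ Cs -> loops = Cs.
Proof.
move=> bCs; have CsE : subgraph_union Cs = rim.
  by rewrite -(bc_union bCs) outermost_boundaryE.
have CsK C : C \in Cs -> exists2 z, K z & C = loop z.
  move=> CCs; have cC := bc_cycle bCs CCs.
  apply: (cycle_in_rim occ0 KsE KN (H := rim)) => //.
  case: cC => c [[e1 [s [et [cE uc Get [us ps sG] uv]]]] Cc deg2].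
  have inbd e : e \in c -> rim e by move=> ec; rewrite -CsE; exists C => //; rewrite Cc.
  exists c; split=> //; exists e1, s, et; split=> //.
    by apply: inbd; rewrite cE mem_rcons mem_head.
  by split=> // e es; apply: inbd; rewrite cE mem_rcons inE es orbT.
apply/fsetP => C; apply/idP/idP => [/mem_loops[z Kz ->]|/CsK/mem_loops//].
(* Some member of [Cs] contains an edge of this loop; being itself a loop, it is this one. *)
have nz := inner_component KN Kz; have [e ez] := loop_neq0 KsE nz.
have : rim e by exact: (loop_rim KsE ez).
rewrite -CsE => -[D DCs eD]; have [w Kw Dw] := CsK D DCs.
rewrite Dw in eD; have nw := inner_component KN Kw.
by rewrite (loop_disjoint KsE KN nz nw ez eD) -Dw.
Qed.

Lemma loops_circuit : exists c, is_circuit G c /\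
  forall e, subgraph_union loops e -> e \in c.
Proof.
have n0 : rim_fset occ Ks N != fset0.
  have nz := inner_component KN (component_origin occ0).
  have [e ez] := loop_neq0 KsE nz.
  by apply/fset0Pn; exists e; apply/(mem_rim_fset N KsE); exact: (loop_rim KsE ez).
have [u [s us]] := euler n0 (rim_even N KsE) (rim_edge_connected occ0 KsE KN).
exists s; split.
  apply: (closed_trail_circuit n0 _ us) => e /(mem_rim_fset N KsE); exact: rim_G0.
rewrite loops_union => e /(mem_rim_fset N KsE) eB.
by case: us => _ _ _ ->.
Qed.

End Geometry.

Theorem theorem1 (R : realType) (occ : set square)
    (occ0 : occ (0, 0)) (finC0 : finite_set (component occ)) :
  exists Cs : {fset {fset edge}},
    unique (boundary_cycles R occ) Cs /\
    exists Cout : seq edge,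
      is_circuit (G0 occ) Cout /\
      forall e, subgraph_union Cs e -> e \in Cout.
Proof.
have /finite_seqP[Ks KE] := finC0.
have KsE z : component occ z <-> z \in Ks by rewrite KE.
have [N1 [N10 /allP b1]] := seq_bounded (fun z : square => z.1) Ks.
have [N2 [N20 /allP b2]] := seq_bounded (fun z : square => z.2) Ks.
have KN z : component occ z -> `|z.1| <= N1 + N2 /\ `|z.2| <= N1 + N2.
  by move=> /KsE zK; have := b1 z zK; have := b2 z zK; move=> /=; lia.
exists (loops occ Ks (N1 + N2)); split.
  split; first exact: loops_boundary_cycles occ0 KsE KN.
  by move=> Cs; exact: loops_unique occ0 KsE KN _.
exact: loops_circuit occ0 KsE KN.
Qed.
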